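(* Let $X$ be a zero-dimensional, locally compact space which is not pseudocompact. Then the cellularity of each of the spaces $\beta_0X\setminus\upsilon_0X$ and $\beta_0X\setminus X$ is at least $2^{\aleph_0}$.
   Context: A zero-dimensional space is a Hausdorff topological space with a base of clopen sets. A space is pseudocompact if every continuous real-valued function on it is bounded. The Banaschewski compactification $\beta_0X$ of a zero-dimensional space $X$ is the (unique up to homeomorphism) compact zero-dimensional space containing $X$ as a dense subspace such that every continuous function $X\to\{0,1\}$ extends continuously to $\beta_0X$. A space is $\mathbb{N}$-compact if it is homeomorphic to a closed subspace of $\mathbb{N}^\kappa$ for some cardinal $\kappa$ ($\mathbb{N}$ discrete). $\upsilon_0X$ is the $\mathbb{N}$-compact space containing $X$ as a dense subspace such that every continuous function $X\to\mathbb{Z}$ extends continuously to $\upsilon_0X\to\mathbb{Z}$; it is regarded as a subspace $X\subseteq\upsilon_0X\subseteq\beta_0X$, namely the set of $p\in\beta_0X$ such that the ultrafilter of clopen sets $\{U\subseteq X \text{ clopen}: p\in\mathrm{cl}_{\beta_0X}U\}$ has the countable intersection property. The cellularity $c(Y)$ of a space $Y$ is the smallest cardinal $\lambda$ such that every pairwise disjoint family of nonempty open subsets of $Y$ has $\lambda$ or fewer members. *)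

(* Defs.v *)
From HB Require Import structures.
From mathcomp Require Import all_boot all_order all_algebra.
From mathcomp Require Import all_classical all_reals all_analysis.
Set Implicit Arguments.
Unset Strict Implicit.
Unset Printing Implicit Defensive.
Import numFieldNormedType.Exports.
Local Open Scope classical_set_scope.
Local Open Scope card_scope.

(* The library's [zero_dimensional] only says that clopen sets separate points,
   which is weaker than having a clopen base when the space is not compact. *)
Definition zero_dimensional_space (X : topologicalType) : Prop :=
  hausdorff_space X /\ basis [set U : set X | clopen U].

Definition pseudocompact (R : realType) (X : topologicalType) : Prop :=
  forall f : X -> R, continuous f -> bounded_fun f.

Definition topological_embedding (X Y : topologicalType) (e : X -> Y) : Prop :=
  injective e /\
  forall U : set X, open U <-> exists2 V : set Y, open V & e @^-1` V = U.

(* [bool] carries the discrete topology. *)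
Definition is_banaschewski (X B : topologicalType) (e : X -> B) : Prop :=
  [/\ compact [set: B],
      zero_dimensional_space B,
      topological_embedding e,
      dense (range e) &
      forall f : X -> bool, continuous f ->
        exists2 g : B -> bool, continuous g & g \o e = f].

Definition countable_intersection_property (T : Type) (G : set (set T)) : Prop :=
  forall H : set (set T), H `<=` G -> countable H ->
    \bigcap_(U in H) U !=set0.

Definition clopen_trace (X B : topologicalType) (e : X -> B) (p : B) :
    set (set X) :=
  [set U : set X | clopen U /\ closure (e @` U) p].

Definition upsilon0 (X B : topologicalType) (e : X -> B) : set B :=
  [set p : B | countable_intersection_property (clopen_trace e p)].

Definition cellular_family (Y : topologicalType) (F : set (set Y)) : Prop :=
  (forall U, F U -> open U /\ U !=set0) /\ trivIset F id.

(* A cardinal is represented by any set of that cardinality. *)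
Definition bounds_cellular_families (Y : topologicalType) (T : Type)
    (L : set T) : Prop :=
  forall F : set (set Y), cellular_family F -> F #<= L.

Lemma card_le_min (T : Type) (P : set (set T)) : P !=set0 ->
  exists2 L, P L & forall M, P M -> L #<= M.
Proof.
move=> P0.
pose Q (F : set (set T -> T)) :=
  (forall c, F c -> forall M, P M -> M (c M)) /\
  (forall c c', F c -> F c' -> forall M, P M -> c M = c' M -> c = c').
have [|F [[Fin Finj] Fmax]] := @Zorn_bigcup _ Q.
  move=> C CQ Ctot; split=> [c [F CF Fc]|c c' [F CF Fc] [G CG Gc']].
    exact: (CQ F CF).1 c Fc.
  by have [FG|GF] := Ctot F G CF CG;
    [apply: (CQ G CG).2 => //; exact: FG|apply: (CQ F CF).2 => //; exact: GF].
have [[L PL Lsub]|noL] :=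
  pselect (exists2 L, P L & L `<=` [set c L | c in F]).
  exists L => // M PM.
  apply: (card_le_trans (subset_card_le Lsub)).
  apply: (card_le_trans (card_image_le _ _)).
  have injM : {in F &, injective (fun c => c M)}.
    by move=> c c' /set_mem Fc /set_mem Fc'; exact: (Finj c c' Fc Fc' M PM).
  have /card_eqPle[_ FM] := inj_card_eq injM.
  apply: (card_le_trans FM); apply: subset_card_le => _ [c Fc <-].
  exact: (Fin c Fc M PM).
have new M : P M -> exists2 x, M x & forall c, F c -> c M <> x.
  move=> PM; apply: contrapT => h; apply: noL; exists M => // x Mx.
  apply: contrapT => nx; apply: h; exists x => // c Fc cx.
  by apply: nx; exists c.
have [M0 PM0] := P0; have [x0 _ _] := new _ PM0.
have /choice[c cP] : forall M, exists x,
    P M -> M x /\ forall c, F c -> c M <> x.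
  move=> M; have [PM|nPM] := pselect (P M); last by exists x0.
  by have [x Mx xP] := new _ PM; exists x.
have Fc : ~ F c by move=> Fc; exact: ((cP _ PM0).2 _ Fc).
exfalso; apply: (Fmax (F `|` [set c])).
  by split=> [|h]; [move=> ?; left|apply: Fc; apply: h; right].
split=> [d [Fd|->] M PM|d d' [Fd|->] [Fd'|->] M PM].
- exact: (Fin d Fd M PM).
- exact: (cP _ PM).1.
- exact: (Finj d d' Fd Fd' M PM).
- by move=> /((cP _ PM).2 _ Fd).
- by move=> /esym /((cP _ PM).2 _ Fd').
- by [].
Qed.

Lemma card_le_total (T U : Type) (A : set T) (B : set U) :
  A #<= B \/ B #<= A.
Proof.
have AE : @inl T U @` A #= A by apply: inj_card_eq => x y _ _ [].
have BE : @inr T U @` B #= B by apply: inj_card_eq => x y _ _ [].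
have [|L [->|->] Lmin] :=
    @card_le_min (T + U)%type [set @inl T U @` A; @inr T U @` B].
- by exists (@inl T U @` A); left.
- left; have := Lmin _ (or_intror erefl).
  by rewrite (card_le_eql AE) (card_le_eqr BE).
- right; have := Lmin _ (or_introl erefl).
  by rewrite (card_le_eql BE) (card_le_eqr AE).
Qed.

Lemma cellularity_subproof (Y : topologicalType) :
  exists L : set (set Y), bounds_cellular_families Y L /\
    forall (T : Type) (M : set T), bounds_cellular_families Y M -> L #<= M.
Proof.
have [|L LY Lmin] := @card_le_min (set Y)
    [set L : set (set Y) | bounds_cellular_families Y L].
  by exists setT => F _; exact: card_leT.
exists L; split=> // T M MY; have [//|ML] := card_le_total L M.
have [M' MM' _] : exists2 M', M' #= M & M' `<=` L by exact/card_subP.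
have M'Y : bounds_cellular_families Y M'.
  by move=> F /MY; rewrite -(card_le_eqr MM').
by rewrite -(card_le_eqr MM'); exact: Lmin.
Qed.

(* The least cardinal bounding all cellular families of [Y], given by a set of
   that cardinality; only its cardinality is meaningful. *)
Definition cellularity (Y : topologicalType) : set (set Y) :=
  projT1 (cid (cellularity_subproof Y)).
Arguments cellularity Y : clear implicits.

Lemma cellularityP (Y : topologicalType) :
  bounds_cellular_families Y (cellularity Y) /\
  forall (T : Type) (M : set T),
    bounds_cellular_families Y M -> cellularity Y #<= M.
Proof. exact: projT2 (cid (cellularity_subproof Y)). Qed.

(* Main.v *)
Require Import Defs.
From mathcomp Require Import all_boot all_order all_algebra.
From mathcomp Require Import all_classical all_reals all_analysis.
From mathcomp Require Import lra.
Import Order.TTheory GRing.Theory Num.Theory numFieldNormedType.Exports.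
Local Open Scope classical_set_scope.
Local Open Scope card_scope.

(** An unbounded continuous function, zero-dimensionality and local compactness
    give pairwise disjoint nonempty compact clopen sets [U n] of [X] that are
    locally finite, so that the union of any subfamily is clopen
    ([not_pseudocompact_spread]). The branches [s] of the binary tree, read
    through an encoding of nodes by integers, are continuum many infinite sets
    of integers any two of which have a finite intersection
    ([mkseq_eq_bounded]). Let [A s] be the union of the [U n] along the branch
    [s], and let [W s] be the clopen subset of [B] that traces [A s] on [X]
    ([banaschewski_clopen_lift]).

    If [s <> s'], then [A s] and [A s'] meet in a subset of a finite union of
    the [U n], which is compact and hence closed in [B]; since [X] is dense, the
    whole of [W s `&` W s'] then lies in [X] ([dense_sub_closure_trace]). So the
    traces of the [W s] on any subspace of [B] that misses [X] are disjoint
    open sets.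

    The traces outside [upsilon0 e] are nonempty: the tails of [A s] are clopen sets that
    decrease to the empty set, and any point of [B] in the closures of all of
    them lies in [W s] but outside [upsilon0 e], because its clopen trace
    contains these tails ([decreasing_clopen_not_upsilon0]). Hence the [W s]
    yield a cellular family of size continuum both outside [upsilon0 e] and
    outside the smaller set [range e]. *)

(** Two distinct branches of the binary tree share only finitely many nodes:
    none of them lies beyond a level where the two differ. *)
Lemma mkseq_eq_bounded (s s' : nat -> bool) : s <> s' ->
  exists m, forall k k', mkseq s k = mkseq s' k' -> k = k' /\ (k <= m)%N.
Proof.
move=> ss'.
have [m sm] : exists m, s m <> s' m.
  apply: contrapT => h; apply: ss'; apply/funext => m.
  by apply: contrapT => sm; apply: h; exists m.
exists m => k k' skk'.
have kk' : k = k' by rewrite -(size_mkseq s k) skk' size_mkseq.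
split=> //; rewrite leqNgt; apply/negP => mk; apply: sm.
have := congr1 (fun t => nth false t m) skk'.
by rewrite /= !nth_mkseq // -kk'.
Qed.

(** The [W i] may overlap outside [D]: clopen subsets of a compactification can
    intersect in the dense subspace and still have disjoint traces on a
    remainder. *)
Lemma card_le_cellularity_sub (B : topologicalType) (D : set B) (I : Type)
    (W : I -> set B) :
  (forall i, open (W i)) -> (forall i, W i `&` D !=set0) ->
  (forall i j, i <> j -> W i `&` W j `&` D = set0) ->
  [set: I] #<= cellularity (set_type D).
Proof.
move=> oW WD Wdisj.
pose V (i : I) : set (set_type D) := set_val @^-1` W i.
have V0 i : V i !=set0.
  have [b [Wb Db]] := WD i.
  by exists (exist _ b (mem_set Db)).
have Vdisj i j : V i `&` V j !=set0 -> i = j.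
  move=> [y [Vi Vj]]; apply: contrapT => /Wdisj ij.
  have : (W i `&` W j `&` D) (set_val y) by split=> //; exact: set_valP.
  by rewrite ij.
have Vinj : {in [set: I] &, injective V}.
  by move=> i j _ _ VV; apply: Vdisj; rewrite -VV setIid.
have cellV : cellular_family (range V).
  split=> [_ [i _ <-]|_ _ [i _ <-] [j _ <-] /= /Vdisj ->//].
  by split; [exists (W i)|exact: V0].
have := (cellularityP (set_type D)).1 _ cellV.
by rewrite (card_le_eql (inj_card_eq Vinj)).
Qed.

Lemma compact_clopen_nbhs (X : topologicalType) (x : X) (N : set X) :
  zero_dimensional_space X -> locally_compact [set: X] -> nbhs x N ->
  exists U, [/\ clopen U, compact U, U x & U `<=` N].
Proof.
move=> [_ [_ Xbase]] lcX xN.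
have [K + [cK _]] := lcX x I; rewrite withinET => xK.
have [U [clU Ux] UNK] := Xbase x _ (filterI xN xK).
exists U; split=> //; last by move=> y /UNK[].
by apply: (subclosed_compact clU.2 cK) => y /UNK[].
Qed.

(** A point has a neighborhood [P n] that meets only the [U k] with [k < n], so
    near that point the union coincides with a finite one, which is closed. *)
Lemma clopen_bigcup_locally_finite (X : topologicalType) (U : nat -> set X)
    (P : nat -> set X) :
  (forall n, clopen (U n)) -> (forall n, open (P n)) ->
  (forall x, exists n, P n x) ->
  (forall n k, (n <= k)%N -> P n `&` U k = set0) ->
  forall I : set nat, clopen (\bigcup_(k in I) U k).
Proof.
move=> clU oP covP PU I; split.
  by apply: bigcup_open => k _; exact: (clU k).1.
move=> x clx; have [n Pnx] := covP x.
have : closed (\bigcup_(k in I `&` `I_n) U k).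
  apply: closed_bigcup; last by move=> k _; exact: (clU k).2.
  exact: finite_setIr.
move=> /(_ x) []; last by move=> k [Ik _] Ux; exists k.
move=> N xN.
have xP : nbhs x (P n) by exact: open_nbhs_nbhs.
have [y [[k Ik Uy] [Ny Py]]] := clx _ (filterI xN xP).
exists y; split=> //; exists k => //; split=> //=.
rewrite ltnNge; apply/negP => nk.
by have : (P n `&` U k) y by []; rewrite PU.
Qed.

Lemma unbounded_spread_seq (R : realType) (T : Type) (g : T -> R) :
  (forall r, exists x, (r < g x)%R) ->
  exists x : nat -> T, (forall n, (n%:R < g (x n))%R) /\
    (forall n k, (n < k)%N -> (g (x n) + 1 < g (x k))%R).
Proof.
move=> /choice[h hP].
pose x := fix x n := if n is m.+1 then h (g (x m) + 1)%R else h 0%R.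
have xS n : (g (x n) + 1 < g (x n.+1))%R by exact: hP.
exists x; split=> [|n].
  elim=> [|n IHn]; first exact: hP.
  by apply: lt_trans (xS n); rewrite -natr1 ltrD2r.
elim=> // k IHk; rewrite ltnS leq_eqVlt => /predU1P[->//|/IHk nk].
by apply: (lt_trans nk); have := xS k; lra.
Qed.

(** Let [f] be unbounded and [g = |f|]. Choose points [x n] whose values under [g]
    are more than [1] apart and tend to infinity, and take [U n] inside the set
    where [g] is within [1/2] of [g (x n)]. The values of [g] separate the [U n],
    and a bound on [g] near a point leaves only finitely many of them there. *)
Lemma not_pseudocompact_spread (R : realType) (X : topologicalType) :
  zero_dimensional_space X -> locally_compact [set: X] -> ~ pseudocompact R X ->
  exists U : nat -> set X, [/\ forall n, U n !=set0,
    forall n, compact (U n),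
    forall n k, U n `&` U k !=set0 -> n = k &
    forall I : set nat, clopen (\bigcup_(n in I) U n)].
Proof.
move=> zX lcX npcX.
have [f [cf unbf]] : exists f : X -> R, continuous f /\ ~ bounded_fun f.
  apply: contrapT => h; apply: npcX => f cf; apply: contrapT => nf.
  by apply: h; exists f.
pose g x := `|f x|%R.
have cg : continuous g by move=> x; apply: cvg_norm; exact: cf.
have [x [xn xS]] : exists x : nat -> X, (forall n, (n%:R < g (x n))%R) /\
    (forall n k, (n < k)%N -> (g (x n) + 1 < g (x k))%R).
  apply: unbounded_spread_seq => r; apply: contrapT => h; apply: unbf.
  exists r; split; first exact: num_real.
  move=> M rM y _; apply: ltW; apply: le_lt_trans rM.
  by rewrite leNgt; apply/negP => ry; apply: h; exists y.
have ball_nbhs n : nbhs (x n) (g @^-1` ball (g (x n)) 2^-1%R).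
  by apply: cg; apply: nbhsx_ballx; rewrite invr_gt0.
have /choice[U UP] : forall n, exists U, [/\ clopen U, compact U, U (x n) &
    U `<=` g @^-1` ball (g (x n)) 2^-1%R].
  by move=> n; exact: compact_clopen_nbhs.
have gU n y : U n y -> (g (x n) - 2^-1 < g y < g (x n) + 2^-1)%R.
  have [_ _ _ UB] := UP n => /UB; rewrite /ball /= ltr_norml => /andP[a b].
  by apply/andP; split; lra.
have Ulast n k : (n < k)%N -> U n `&` U k = set0.
  move=> /xS nk; apply/seteqP; split=> // y [/gU/andP[_ ny] /gU/andP[ky _]].
  by exfalso; lra.
exists U; split.
- by move=> n; exists (x n); have [] := UP n.
- by move=> n; have [] := UP n.
- move=> n k; case: (ltngtP n k) => // [/Ulast->|/Ulast]; first by case.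
  by rewrite setIC => ->; case.
- apply: (@clopen_bigcup_locally_finite _ _
    (fun n => g @^-1` [set t | (t < n%:R - 1)%R])).
  + by move=> n; have [] := UP n.
  + by move=> n; apply: open_comp; [move=> y _; exact: cg|exact: open_lt].
  + move=> y; exists (Num.truncn (g y + 1)).+1 => /=.
    by have := truncnS_gt (g y + 1); lra.
  + move=> n k nk; apply/seteqP; split=> // y [/= gy /gU/andP[ky _]].
    have kx := xn k; have nkR : (n%:R <= k%:R :> R)%R by rewrite ler_nat.
    by exfalso; lra.
Qed.

Lemma embedding_continuous (X B : topologicalType) (e : X -> B) :
  topological_embedding e -> continuous e.
Proof. by move=> [_ eP]; apply/continuousP => V oV; apply/eP; exists V. Qed.

Lemma dense_sub_closure_trace (X B : topologicalType) (e : X -> B) (W : set B) :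
  dense (range e) -> open W -> W `<=` closure (e @` (e @^-1` W)).
Proof.
move=> de oW p Wp N /nbhs_interior pN.
have [] := de (W `&` interior N).
- by exists p; split=> //; exact: nbhs_singleton.
- by apply: openI => //; exact: open_interior.
- move=> y [[Wy Ny] [x _ xy]]; rewrite -{}xy in Wy Ny.
  by exists (e x); split; [exists x|exact: interior_subset].
Qed.

(** The indicator function of [A] is continuous, and its extension to [B] is the
    indicator function of the lift. *)
Lemma banaschewski_clopen_lift (X B : topologicalType) (e : X -> B) (A : set X) :
  is_banaschewski e -> clopen A -> exists2 W, clopen W & e @^-1` W = A.
Proof.
move=> [_ _ _ _ ext] [oA cA].
have [|g cg ge] := ext (fun x => `[< A x >]).
  move=> x V /nbhs_singleton Vx; have [Ax|nAx] := pselect (A x).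
    apply: filterS (open_nbhs_nbhs (conj oA Ax)) => y Ay /=.
    by move: Vx; rewrite (asboolT Ax) (asboolT Ay).
  apply: filterS (open_nbhs_nbhs (conj (closed_openC cA) nAx)) => y nAy /=.
  by move: Vx; rewrite (asboolF nAx) (asboolF nAy).
exists (g @^-1` [set true]).
  apply: preimage_clopen => //; split; first exact: discrete_open.
  exact: discrete_closed.
by rewrite -comp_preimage ge; apply/seteqP; split=> x /=;
  [move/asboolW|move/asboolT].
Qed.

(** For [p = e x], every clopen set in the trace contains [x] itself. *)
Lemma range_sub_upsilon0 (X B : topologicalType) (e : X -> B) :
  topological_embedding e -> range e `<=` upsilon0 e.
Proof.
move=> [_ eP] _ [x _ <-] H Htr _; exists x => U /Htr[[_ cU] clU].
apply: contrapT => nUx.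
have /eP[V oV VU] := closed_openC cU.
have Vex : V (e x) by rewrite -[V _]/((e @^-1` V) x) VU.
have [_ [[y Uy <-] Vy]] := clU _ (open_nbhs_nbhs (conj oV Vex)).
by have : (e @^-1` V) y by []; rewrite VU.
Qed.

(** By compactness the sets [A n] accumulate at a point of [B]; every [A n] belongs
    to the clopen trace of that point, and together they violate the countable
    intersection property. *)
Lemma decreasing_clopen_not_upsilon0 (X B : topologicalType) (e : X -> B)
    (A : nat -> set X) :
  compact [set: B] -> (forall n, clopen (A n)) -> (forall n, A n !=set0) ->
  (forall n k, (n <= k)%N -> A k `<=` A n) ->
  \bigcap_n A n = set0 ->
  exists p, ~ upsilon0 e p /\ closure (e @` A 0%N) p.
Proof.
move=> cB clA A0 Adec Acap.
pose F := filter_from [set: nat] (fun n => e @` A n).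
have FF : ProperFilter F.
  apply: filter_from_proper; last first.
    by move=> n _; have [x Ax] := A0 n; exists (e x), x.
  apply: filter_fromT_filter; first by exists 0%N.
  move=> i j; exists (maxn i j) => _ [x Ax <-].
  by split; exists x => //; apply: Adec Ax; rewrite (leq_maxl, leq_maxr).
have [|p [_ Fp]] := cB F FF; first exact: filterT.
have clp n : closure (e @` A n) p by move=> N; apply: Fp; exists n.
exists p; split=> // up.
have [|| x xA] := up (range A).
- by move=> _ [n _ <-].
- exact: card_image_le.
- have : (\bigcap_n A n) x by move=> n _; apply: xA; exists n.
  by rewrite Acap.
Qed.

Theorem corollary3p13 (R : realType) (X B : topologicalType) (e : X -> B)
    (zeroX : zero_dimensional_space X)
    (lcX : locally_compact [set: X])
    (npcX : ~ pseudocompact R X)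
    (betaX : is_banaschewski e) :
  [set: nat -> bool] #<= cellularity (set_type (~` upsilon0 e)) /\
  [set: nat -> bool] #<= cellularity (set_type (~` range e)).
Proof.
have [U [U0 cptU Udisj clU]] := @not_pseudocompact_spread R X zeroX lcX npcX.
have [cB [hB _] emb de _] := betaX.
(* [N s n] codes the nodes of level at least [n] on the branch [s]; the [A s n]
   are the tails of [A s 0]. *)
pose N (s : nat -> bool) n := [set pickle (mkseq s k) | k in [set k | (n <= k)%N]].
pose A s n := \bigcup_(i in N s n) U i.
have /choice[W WP] : forall s, exists W : set B, clopen W /\ e @^-1` W = A s 0%N.
  move=> s.
  by have [W] := banaschewski_clopen_lift _ _ e _ betaX (clU (N s 0%N)); exists W.
have oW s : open (W s) by exact: (WP s).1.1.
(* Since the [U i] are disjoint, a point lies over at most one level of [s]. *)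
have A_tail s x : (\bigcap_n A s n) x -> False.
  move=> Ax; have [_ [k _ <-] Ukx] := Ax 0%N I.
  have [_ [k' kk' <-] Uk'x] := Ax k.+1 I.
  have := Udisj _ _ (ex_intro _ x (conj Ukx Uk'x)).
  move=> /(pcan_inj pickleK)/(congr1 size); rewrite !size_mkseq => kE.
  by move: kk'; rewrite /= -kE ltnn.
have Wups s : W s `&` ~` upsilon0 e !=set0.
  have [||||p [up clp]] := @decreasing_clopen_not_upsilon0 X B e (A s) cB.
  - by move=> n; exact: clU.
  - move=> n; have [x Ux] := U0 (pickle (mkseq s n)).
    by exists x; exists (pickle (mkseq s n)) => //; exists n => /=.
  - move=> n k nk x [_ [l kl <-] Ulx]; exists (pickle (mkseq s l)) => //.
    by exists l => //=; exact: leq_trans kl.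
  - by apply/seteqP; split=> // x /A_tail.
  exists p; split=> //.
  apply: (WP s).1.2; apply: closure_subset clp => _ [x + <-].
  by rewrite -(WP s).2.
have Wran s s' : s <> s' -> W s `&` W s' `<=` range e.
  move=> /(mkseq_eq_bounded s s')[m mP].
  pose K := \bigcup_(k in `I_m.+1) U (pickle (mkseq s k)).
  have cK : compact K by rewrite /K bigcup_mkord; apply: bigsetU_compact.
  have ceK : closed (e @` K).
    apply: compact_closed => //; apply: continuous_compact => //.
    by apply: continuous_subspaceT; exact: embedding_continuous.
  have sub : e @` (e @^-1` (W s `&` W s')) `<=` e @` K.
    apply: image_subset; rewrite preimage_setI (WP s).2 (WP s').2.
    move=> x [[_ [k _ <-] Ux] [_ [k' _ <-] U'x]].
    have /(pcan_inj pickleK)/mP[_ km] := Udisj _ _ (ex_intro _ x (conj Ux U'x)).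
    by exists k.
  move=> p Wp; have := dense_sub_closure_trace _ _ _ _ de (openI (oW s) (oW s')) p Wp.
  by move=> /(closure_subset sub)/ceK; apply: image_subset.
(* Both remainders at once: [C] stands for [upsilon0 e] or [range e]. *)
have main (C : set B) : range e `<=` C -> C `<=` upsilon0 e ->
    [set: nat -> bool] #<= cellularity (set_type (~` C)).
  move=> eC Cu; apply: (@card_le_cellularity_sub _ _ _ W) => // [s|s s' ss'].
    by have [p [Wp up]] := Wups s; exists p; split=> // /Cu.
  by apply/seteqP; split=> // p [/(Wran _ _ ss')/eC].
by have reu := range_sub_upsilon0 _ _ _ emb; split; exact: main.
Qed.
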